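(* Let $(X,d,A)$ be a metric pair with $A\neq\varnothing$ such that $(X/A,\overline d_1,[A])$ is uniformly discrete, let $\psi:[0,\infty)\to[0,\infty)$ satisfy $\psi(0)=0$ and $\sum_{x,y\in X\setminus A,\,x\ne y}\psi(\overline d_1(x,y))<\infty$, and let $(p_t^\psi)_{t\ge0}$ be the associated convolution semigroup on $K(X,A)$. Then the subgroup $\bigl\langle\bigcup_{q\in\mathbb Q_{\ge0}}\operatorname{supp}(p_q^\psi)\bigr\rangle$ of $K(X,A)$ is countable, and $$\operatorname{supp}(p_t^\psi)\subset\bigcup_{q\in\mathbb Q_{\ge0}}\operatorname{supp}(p_q^\psi)$$ for all $t\ge0$.
   Context: Metric pair: $(X,d)$ is a metric space and $A\subseteq X$ is nonempty. Put $d(x,A)=\inf_{a\in A}d(x,a)$ and $d_1(x,y)=\min(d(x,y),d(x,A)+d(y,A))$. $X/A$ is the quotient collapsing $A$ to a basepoint $[A]$, and $\overline d_1$ is the metric on $X/A$ induced by $d_1$ (so $\overline d_1(x,y)=d_1(x,y)$ and $\overline d_1(x,[A])=d(x,A)$ for $x,y\in X\setminus A$). Uniformly discrete means: there is $c>0$ with $\overline d_1(u,v)\ge c$ for all distinct $u,v\in X/A$. $D(X,A)$ is the free commutative monoid on $X$ modulo the submonoid generated by $A$; $K(X,A)$ is its Grothendieck group, identified with $\bigoplus_{x\in X\setminus A}\mathbb Z e_x$ and regarded as a discrete abelian group, with compact dual $\widehat{K(X,A)}$. Sums over possibly uncountable index sets of nonnegative terms are suprema of finite partial sums. For $\theta\in\widehat{K(X,A)}$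 put $\lambda^\psi(\theta)=\frac12\sum_{x,y\in X\setminus A,\,x\neq y}\psi(\overline d_1(x,y))\,(1-\Re\,\theta(e_x-e_y))$. $(p_t^\psi)_{t\ge0}$ is the unique convolution semigroup of probability measures on $K(X,A)$ with $\sum_g p_t^\psi(g)\overline{\theta(g)}=e^{-t\lambda^\psi(\theta)}$ for all $\theta\in\widehat{K(X,A)}$ and $t\ge0$. $\operatorname{supp}(p)=\{g:p(g)>0\}$, and $\langle S\rangle$ denotes the subgroup generated by $S$. *)

(* Defs.v *)
From HB Require Import structures.
From mathcomp Require Import all_boot all_order all_algebra.
From mathcomp Require Import finmap complex freeg.
From mathcomp Require Import all_classical all_reals all_analysis.
From mathcomp Require Import showcase.summability.

Set Implicit Arguments.
Unset Strict Implicit.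
Unset Printing Implicit Defensive.
Import Order.TTheory GRing.Theory Num.Theory.
Import numFieldNormedType.Exports.

Local Open Scope classical_set_scope.
Local Open Scope ring_scope.

Section MetricPair.
Context {R : realType} {X : metricType R}.
Implicit Types (A : set X) (psi : R -> R).

Definition dist_set A (x : X) : R := inf [set mdist x a | a in A].

Definition d1 A (x y : X) : R :=
  Order.min (mdist x y) (dist_set A x + dist_set A y).

(* For nonempty [A], the set X/A is (X \ A) together with the point [A], which *)
(* is encoded by [None]; [quo_proj] is the canonical projection.               *)
Definition quo A : Type := option (~` A).

Definition quo_proj A (x : X) : quo A := insub x.

Definition d1bar A (u v : quo A) : R :=
  match u, v with
  | Some x, Some y => d1 A (\val x) (\val y)
  | Some x, None => dist_set A (\val x)
  | None, Some y => dist_set A (\val y)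
  | None, None => 0
  end.

Lemma dist_set_le A (x a : X) : A a -> dist_set A x <= mdist x a.
Proof.
move=> Aa; apply: ge_inf; last by exists a.
by exists 0 => _ [b _ <-]; exact: mdist_ge0.
Qed.

Lemma dist_set_ge0 A (x : X) : A !=set0 -> 0 <= dist_set A x.
Proof.
move=> [a Aa]; apply: lb_le_inf; first by exists (mdist x a), a.
by move=> _ [b _ <-]; exact: mdist_ge0.
Qed.

Lemma dist_set_in A (a : X) : A a -> dist_set A a = 0.
Proof.
move=> Aa; apply/eqP; rewrite eq_le dist_set_ge0 ?andbT; last by exists a.
by rewrite -(mdistxx a) dist_set_le.
Qed.

(* [d1bar] is the function induced by [d1] on the quotient. *)
Lemma d1bar_proj A (x y : X) :
  A !=set0 -> d1bar (quo_proj A x) (quo_proj A y) = d1 A x y.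
Proof.
move=> A0; rewrite /quo_proj.
have inA z : z \notin ~` A -> A z.
  by move=> zA; apply: contrapT => nAz; move/negP: zA; apply; rewrite inE.
case: insubP => [u _ <-|/inA Ax]; case: insubP => [v _ <-|/inA Ay] //=.
- by rewrite /d1 (dist_set_in Ay) addr0 min_r // dist_set_le.
- by rewrite /d1 (dist_set_in Ax) add0r min_r // metric_sym dist_set_le.
- by rewrite /d1 (dist_set_in Ax) (dist_set_in Ay) addr0 min_r ?mdist_ge0.
Qed.

Definition quo_uniformly_discrete A : Prop :=
  exists2 c : R, 0 < c & forall u v : quo A, u <> v -> c <= d1bar u v.

Definition K A := {freeg (~` A) / int}.

Definition e A (x : ~` A) : K A := Freeg [:: (1, x)].

Definition offdiag A : set (~` A * ~` A) := [set xy | xy.1 <> xy.2].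
Arguments offdiag : clear implicits.

Definition weight A psi (xy : ~` A * ~` A) : R :=
  psi (d1bar (Some xy.1) (Some xy.2)).

(* [K A] is discrete, so continuity of characters is automatic. *)
Definition is_character A (theta : K A -> R[i]) : Prop :=
  (forall g h, theta (g + h) = theta g * theta h) /\
  (forall g, `|theta g| = 1).

(* The sum is finite as soon as [weight A psi] has a finite sum, so that *)
(* [fine] does not alter its value in that case.                         *)
Definition lambda A psi (theta : K A -> R[i]) : R :=
  2^-1 * fine (\esum_(xy in offdiag A)
    (weight psi xy * (1 - complex.Re (theta (e xy.1 - e xy.2))))%:E).

(* A probability measure on the discrete group [K A] is given by its mass *)
(* function.                                                              *)
Definition is_probability A (p : K A -> R) : Prop :=
  (forall g, 0 <= p g) /\ (\esum_(g in [set: K A]) (p g)%:E = 1)%E.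

Definition convolution A (p q : K A -> R) (g : K A) : \bar R :=
  \esum_(h in [set: K A]) (p h * q (g - h))%:E.

Definition is_convolution_semigroup A (p : R -> K A -> R) : Prop :=
  [/\ forall t, 0 <= t -> is_probability (p t),
      forall g, p 0 g = (g == 0)%:R
    & forall s t, 0 <= s -> 0 <= t ->
        forall g, (p (s + t) g)%:E = convolution (p s) (p t) g].

(* The Fourier series is the limit of its partial sums along the net of *)
(* finite subsets of [K A].                                             *)
Definition associated_semigroup A psi (p : R -> K A -> R) : Prop :=
  is_convolution_semigroup p /\
  forall theta, is_character theta -> forall t, 0 <= t ->
    partial_sum (fun g => (p t g)%:C%C * (theta g)^*%C : R[i]^o) F
      @[F --> totally] --> ((expR (- (t * lambda psi theta)))%:C%C : R[i]^o).

Definition supp A (p : K A -> R) : set (K A) := [set g | 0 < p g].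

Definition subgroup_gen A (S : set (K A)) : set (K A) :=
  smallest [set H : set (K A) | zmod_closed (mem H)] S.

Definition rational_supp A (p : R -> K A -> R) : set (K A) :=
  \bigcup_(q in [set q : rat | 0 <= q]) supp (p (ratr q)).

End MetricPair.

Arguments offdiag {R X} A xy.

(* Main.v *)
Require Import Defs.
From HB Require Import structures.
From mathcomp Require Import all_boot all_order all_algebra.
From mathcomp Require Import finmap complex freeg.
From mathcomp Require Import all_classical all_reals all_analysis.
From mathcomp Require Import showcase.summability.
From mathcomp Require Import lra.

Set Implicit Arguments.
Unset Strict Implicit.
Unset Printing Implicit Defensive.
Import Order.TTheory GRing.Theory Num.Theory.
Import numFieldNormedType.Exports.

Local Open Scope classical_set_scope.
Local Open Scope ring_scope.

(* The total mass of [psi] bounds [lambda] by a constant [L], so the Fourier   *)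
(* transform of [p t] is at least [exp (- t L)]. Its average over the dual     *)
(* group is [p t 0], hence [p t 0 > 0]. Then [p (t + s) g >= p t g * p s 0]    *)
(* shows that supports increase with time, so [supp (p t)] lies in             *)
(* [supp (p q)] for every rational [q > t]. Each support is countable because  *)
(* [p t] is summable.                                                          *)

(** The heart is positivity at the identity, [probability_0_gt0]: if the Fourier transform is
    bounded below by one c > 0 over all characters, then averaging it over a finite family of
    characters that cancels at the nonzero points of a large finite set
    ([exists_vanishing_characters]) forces mass at 0. The uniform bound comes from [lambda_le], and
    [supp_semigroup_le] then pushes supports forward to rational times. Countability is separate:
    [countable_supp] at each rational time, then [countable_subgroup_gen]. *)

Section Characters.
Context {R : realType} {X : metricType R} {A : set X}.
Implicit Types (g h : K A) (theta : K A -> R[i]).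

Lemma is_character1 : is_character ((fun=> 1) : K A -> R[i]).
Proof. by split=> *; rewrite ?mulr1 ?normr1. Qed.

Lemma is_characterM theta1 theta2 : is_character theta1 ->
  is_character theta2 -> is_character (fun g => theta1 g * theta2 g).
Proof.
move=> [D1 n1] [D2 n2]; split=> [g h|g]; first by rewrite D1 D2 mulrACA.
by rewrite normrM n1 n2 mulr1.
Qed.

Lemma character_Re_le1 theta g : is_character theta ->
  `|complex.Re (theta g)| <= 1.
Proof.
by move=> [_ theta1]; have := normc_ge_Re (theta g); rewrite theta1 lecR.
Qed.

(** Since [K A] is free, every z on the unit circle and every basis point x give a character h |-> z
    ^ (coefficient of h at x). Take x with nonzero coefficient n in g, and z a |n|-th root of -1;
    the sign of n is harmless because -1 is its own inverse. *)
Lemma exists_character_eqN1 g :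
  g != 0 -> exists2 chi : K A -> R[i], is_character chi & chi g = -1.
Proof.
move=> g0; have [x gx0] : exists x, coeff x g != 0.
  apply: contrapT => coeff0g; case/eqP: g0; apply/eqP/freeg_eqP => x.
  by rewrite coeff0; apply/eqP/negPn/negP => gx; apply: coeff0g; exists x.
have n_gt0 : (0 < `|coeff x g|)%N by rewrite absz_gt0.
pose z : R[i] := `|coeff x g|%N.-root (-1).
have nz : `|z| = 1 by rewrite norm_rootC normrN1 rootC1.
have z0 : z != 0 by rewrite -normr_gt0 nz.
have zn : z ^+ `|coeff x g|%N = -1 by rewrite rootCK.
have nzX m : `|z ^+ m| = 1 by rewrite normrX nz expr1n.
clearbody z; exists (fun h => z ^ coeff x h).
  split=> [h1 h2|h]; first by rewrite coeffD expfzDr.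
  by case: (coeff x h) => m; rewrite /exprz ?normfV ?nzX ?invr1.
by case: (coeff x g) zn => m /= zn; rewrite /exprz zn ?invrN ?invr1.
Qed.

(** A finite form of the orthogonality of characters. Each new nonzero point g doubles the family,
    multiplying its sum by 1 + chi with chi g = -1: this creates a zero at g and keeps the earlier
    ones. *)
Lemma exists_vanishing_characters (F : seq (K A)) :
  exists (I : finType) (theta : I -> K A -> R[i]),
    [/\ (0 < #|I|)%N, forall i, is_character (theta i)
      & forall g, g \in F -> g != 0 -> \sum_i theta i g = 0].
Proof.
elim: F => [|g F [I [theta [I0 theta_char thetaF]]]].
  exists unit, (fun _ _ => 1); split=> //; first by rewrite card_unit.
  by move=> _; exact: is_character1.
have [->|g0] := eqVneq g 0.
  exists I, theta; split=> // h; rewrite inE => /orP[/eqP->|].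
    by rewrite eqxx.
  exact: thetaF.
have [chi chi_char chig] := exists_character_eqN1 g0.
pose theta' (bi : bool * I) h := (if bi.1 then chi h else 1) * theta bi.2 h.
have sumE h : \sum_bi theta' bi h = (chi h + 1) * \sum_i theta i h.
  rewrite -(pair_bigA _ (fun b i => theta' (b, i) h)) /= big_bool /= mulrDl.
  by rewrite !mulr_sumr.
exists (bool * I)%type, theta'; split.
- by rewrite card_prod card_bool muln_gt0.
- move=> [[] i]; apply: is_characterM (theta_char i) => //.
  exact: is_character1.
- move=> h; rewrite sumE inE => /orP[/eqP->|hF h0].
    by rewrite chig addNr mul0r.
  by rewrite (thetaF h hF h0) mulr0.
Qed.

End Characters.

Section EsumFset.
Context {R : realType} {T : choiceType}.
Implicit Types (f : T -> R) (J : {fset T}).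

Lemma sum_fset_le_esum f J :
  ((\sum_(x <- J) f x)%:E <= \esum_(x in [set: T]) (f x)%:E)%E.
Proof.
apply: esum_ge; exists [set` J]; first by split.
by rewrite fsbig_finite//= set_fsetK sumEFin.
Qed.

(** Choose [J] with sum above s - eps. The sum over the union of [J] and [J'] is still at most s, so
    the part of [J'] outside [J] contributes less than eps. *)
Lemma esum_fset_tail f (s eps : R) :
  (\esum_(x in [set: T]) (f x)%:E = s%:E)%E -> 0 < eps ->
  exists J : {fset _}, forall J', \sum_(x <- J' | x \notin J) f x < eps.
Proof.
move=> fs eps0.
have [||_ [S [finS _] <-]] := @ub_ereal_sup_adherent R
  [set \sum_(x \in S) (f x)%:E | S in fsets [set: T]]%E eps => //.
  by rewrite [ereal_sup _]fs.
rewrite [ereal_sup _]fs fsbig_finite// sumEFin -EFinB lte_fin => sS.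
exists (fset_set S) => J'; set J := fset_set S in sS *.
have := sum_fset_le_esum f (J `|` J')%fset.
rewrite fs lee_fin (bigID (mem J))/=.
rewrite [X in X + _](_ : _ = \sum_(x <- J) f x); last first.
  apply: eq_fbig_cond => // x; rewrite !inE/= andbT.
  by case: (x \in J); rewrite ?andbF.
rewrite [X in _ + X](_ : _ = \sum_(x <- J' | x \notin J) f x); last first.
  apply: eq_fbig_cond => // x; rewrite !inE/=.
  by case: (x \in J); rewrite ?andbF.
rewrite -(ltrD2l (\sum_(x <- J) f x)) => /le_lt_trans; apply.
by rewrite -ltrBlDr.
Qed.

End EsumFset.

Section Probability.
Context {R : realType} {X : metricType R} {A : set X}.
Implicit Types (p q : K A -> R) (J : {fset K A}).

(** All points of mass at least 1/(n+1) lie in a finite set [J n], and these sets exhaust the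
    support. *)
Lemma countable_supp p : is_probability p -> countable (supp p).
Proof.
move=> [p0 p1].
have tail n : exists J, forall J' : {fset _},
    \sum_(g <- J' | g \notin J) p g < n.+1%:R^-1.
  by apply: (@esum_fset_tail _ _ p 1) => //; rewrite invr_gt0.
have [J JP] := choice tail.
apply: (@sub_countable _ _ _ (\bigcup_n [set` J n])).
  apply: subset_card_le => g pg; apply: contrapT => gJ.
  have [n] := @ltr_add_invr R 0 (p g) pg.
  rewrite add0r; apply/negP; rewrite -leNgt ltW//.
  rewrite (le_lt_trans _ (JP n [fset g]%fset))// big_mkcond big_seq_fset1/=.
  by case: ifPn => // /negPn gJn; exfalso; apply: gJ; exists n.
by apply: bigcup_countable => // n _; exact: countable_fset.
Qed.

Lemma convolution_ge p q g h :
  ((p h * q (g - h))%:E <= convolution p q g)%E.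
Proof.
have := sum_fset_le_esum (fun h => p h * q (g - h)) [fset h]%fset.
by rewrite big_seq_fset1.
Qed.

Lemma Re_partial_sum p (theta : K A -> R[i]) J :
  complex.Re (partial_sum (fun g => (p g)%:C%C * (theta g)^*%C : R[i]^o) J)
  = \sum_(g <- J) p g * complex.Re (theta g).
Proof.
rewrite /partial_sum (big_morph (@complex.Re R) (id1 := 0) (op1 := +%R))//.
  rewrite [RHS]big_seq_fsetE; apply: eq_bigr => g _ /=.
  by case: (theta _) => a b /=; rewrite mul0r subr0.
by move=> [a b] [c d].
Qed.

(* An average over finitely many characters that vanishes at the nonzero *)
(* points of a finite set carrying most of the mass stands in for the    *)
(* Haar integral over the dual group.                                    *)
Lemma probability_0_gt0 p (c : R) : is_probability p -> 0 < c ->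
  (forall theta, is_character theta -> exists2 l : R, c <= l &
    partial_sum (fun g => (p g)%:C%C * (theta g)^*%C : R[i]^o) F
      @[F --> totally] --> (l%:C%C : R[i]^o)) ->
  0 < p 0.
Proof.
move=> [p0 p1] c0 fourier; rewrite lt_def p0 andbT; apply/eqP => p00.
(* Half of [c] bounds the mass outside [J]; the other half bounds the error of the finite Fourier
   sums, which therefore stay above c / 2. *)
have c20 : 0 < c / 2 by rewrite divr_gt0.
have [J JP] := @esum_fset_tail _ _ p 1 _ p1 c20.
have [I [theta [I0 theta_char thetaJ]]] :=
  exists_vanishing_characters (J : seq _).
have totallyP : ProperFilter (@totally (K A)) := totally_filter.
have near_c i : \forall J' \near @totally (K A),
    c / 2 < \sum_(g <- (J' : {fset K A})) p g * complex.Re (theta i g).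
  have [l cl /cvgr_dist_lt] := fourier _ (theta_char i).
  move=> /(_ (c / 2)%:C%C); rewrite ltcR => /(_ c20).
  apply: (@filterS _ (@totally (K A))) => J' dist_lt; rewrite -Re_partial_sum.
  have := le_lt_trans (normc_ge_Re _) dist_lt.
  set S := partial_sum _ _; rewrite ltcR => /(le_lt_trans (ler_norm _)).
  rewrite (_ : complex.Re _ = l - complex.Re S); last by case: S.
  lra.
(* As [I] is finite, one [J'] serves all characters of the family. *)
have [J' J'P] : exists J' : {fset K A},
    forall i, c / 2 < \sum_(g <- J') p g * complex.Re (theta i g).
  exact: (@filter_ex _ _ totallyP _ (filter_forall _ near_c)).
have ReS g : complex.Re (\sum_i theta i g) = \sum_i complex.Re (theta i g).
  by apply: big_morph => // -[a b] [a' b'].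
(* The double sum over [I] and [J'] is squeezed between the two sides. For the upper bound, real
   parts are at most 1 outside [J]; inside [J] the characters cancel at nonzero points, and 0
   contributes nothing by the assumption [p00]. *)
have : \sum_(i : I) c / 2 < \sum_(i : I) c / 2.
  have /card_gt0P[i0 _] := I0.
  apply: (@lt_trans _ _ (\sum_i \sum_(g <- J') p g * complex.Re (theta i g))).
    by apply: ltr_sum => //; apply/hasP; exists i0; rewrite // mem_index_enum.
  apply: (@le_lt_trans _ _ (\sum_(i : I) \sum_(g <- J' | g \notin J) p g)).
    rewrite exchange_big [leRHS]exchange_big [leRHS]big_mkcond /=.
    apply: ler_sum => g _; case: ifPn => [gJ|/negPn gJ].
      apply: ler_sum => i _; rewrite ler_piMr//.
      exact: le_trans (ler_norm _) (character_Re_le1 g (theta_char i)).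
    rewrite -mulr_sumr -ReS; have [->|g0] := eqVneq g 0.
      by rewrite p00 mul0r.
    by rewrite thetaJ// mulr0.
  by apply: ltr_sum => //; apply/hasP; exists i0; rewrite // mem_index_enum.
by rewrite ltxx.
Qed.

End Probability.

Section Subgroup.
Context {R : realType} {X : metricType R} {A : set X}.

(** Integer combinations of elements of [S] are coded by finite lists of pairs (coefficient, index),
    of which there are countably many, and their values form a subgroup containing [S]. *)
Lemma countable_subgroup_gen (S : set (K A)) :
  countable S -> countable (subgroup_gen S).
Proof.
(* [g] decodes an index; the default 0 off the image of [S] is harmless, since only an upper bound
   for the subgroup is needed. *)
move=> /pcard_injP[f f_inj]; pose g := 'pinv_(fun=> 0) S f.
pose comb (s : seq (int * nat)) : K A := \sum_(z <- s) g z.2 *~ z.1.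
apply: (@sub_countable _ _ _ (range comb)); last first.
  exact: sub_countable (card_image_le _ _) (countableP _).
apply: subset_card_le; apply: smallest_sub => [/=|x Sx]; last first.
  exists [:: (1, f x)] => //; rewrite /comb big_seq1 mulr1z /g /=.
  by rewrite pinvKV ?inE.
split; first by rewrite inE; exists [::] => //; rewrite /comb big_nil.
move=> x y; rewrite !inE => -[s _ <-] [s' _ <-].
exists (s ++ [seq (- z.1, z.2) | z <- s']) => //.
rewrite /comb big_cat big_map -sumrN; congr (_ + _).
by apply: eq_bigr => z _; rewrite mulrNz.
Qed.

End Subgroup.

Section Semigroup.
Context {R : realType} {X : metricType R} {A : set X}.
Context (psi : R -> R) (p : R -> K A -> R).
Context (psi_ge0 : forall r : R, 0 <= r -> 0 <= psi r).
Context (psi_sum : (\esum_(xy in offdiag A) (weight psi xy)%:E < +oo)%E).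

Lemma weight_ge0 (xy : ~` A * ~` A) : A !=set0 -> 0 <= weight psi xy.
Proof.
move=> A0; apply: psi_ge0; rewrite /= /d1 le_min mdist_ge0 /=.
by rewrite addr_ge0// dist_set_ge0.
Qed.

(** Each factor 1 - Re theta lies between 0 and 2, and the 2 is absorbed by the 1/2 in [lambda]. *)
Lemma lambda_le (theta : K A -> R[i]) : A !=set0 -> is_character theta ->
  lambda psi theta <= fine (\esum_(xy in offdiag A) (weight psi xy)%:E).
Proof.
move=> A0 theta_char; rewrite /lambda ler_pdivrMl// mulr2n mulrDl mul1r.
have w0 xy := weight_ge0 xy A0.
have sum_fin : (\esum_(xy in offdiag A) (weight psi xy)%:E)%E \is a fin_num.
  by rewrite ge0_fin_numE// esum_ge0// => xy _; rewrite lee_fin.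
have Re1 g : -1 <= complex.Re (theta g) <= 1.
  by rewrite -ler_norml character_Re_le1.
have le2 : (\esum_(xy in offdiag A)
    (weight psi xy * (1 - complex.Re (theta (e xy.1 - e xy.2))))%:E <=
    \esum_(xy in offdiag A) (weight psi xy)%:E +
    \esum_(xy in offdiag A) (weight psi xy)%:E)%E.
  rewrite -esumD => [|xy _|xy _]; rewrite ?lee_fin//.
  apply: le_esum => xy _; rewrite -EFinD lee_fin -[leRHS]mulr2n -mulr_natr.
  have /andP[lo _] := Re1 (e xy.1 - e xy.2).
  by apply: ler_wpM2l => //; lra.
(* [fine] is monotone only on finite values, so the sum defining [lambda] must also be shown finite;
   [le2] gives this. *)
rewrite -fineD//; apply: fine_le => //; last by rewrite fin_numD sum_fin.
rewrite ge0_fin_numE.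
  by rewrite (le_lt_trans le2)// lte_add_pinfty.
apply: esum_ge0 => xy _; rewrite lee_fin mulr_ge0// subr_ge0.
by have /andP[] := Re1 (e xy.1 - e xy.2).
Qed.

Context (p_semigroup : associated_semigroup psi p).

Lemma semigroup_0_gt0 (t : R) : A !=set0 -> 0 <= t -> 0 < p t 0.
Proof.
move=> A0 t0; have [[pP _ _] fourier] := p_semigroup.
pose L := fine (\esum_(xy in offdiag A) (weight psi xy)%:E).
apply: (@probability_0_gt0 _ _ _ _ (expR (- (t * L)))).
- exact: pP.
- exact: expR_gt0.
- move=> theta theta_char; exists (expR (- (t * lambda psi theta))).
    by rewrite ler_expR lerN2 ler_wpM2l// lambda_le.
  exact: fourier.
Qed.

(** Keep only the term h = g of the convolution of [p s] and [p (t - s)] at g: it is p s g * p (t -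
    s) 0, and its second factor is positive. *)
Lemma supp_semigroup_le (s t : R) : A !=set0 -> 0 <= s -> s <= t ->
  supp (p s) `<=` supp (p t).
Proof.
move=> A0 s0 st g psg; have [[_ _ pD] _] := p_semigroup.
have ts0 : 0 <= t - s by rewrite subr_ge0.
have := convolution_ge (p s) (p (t - s)) g g.
rewrite -pD// subrr lee_fin (addrC s) subrK; apply: lt_le_trans.
by rewrite mulr_gt0// semigroup_0_gt0.
Qed.

End Semigroup.

Theorem lemma9 (R : realType) (X : metricType R) (A : set X)
    (A_nonempty : A !=set0)
    (A_discrete : quo_uniformly_discrete A)
    (psi : R -> R)
    (psi_ge0 : forall r : R, 0 <= r -> 0 <= psi r)
    (psi0 : psi 0 = 0)
    (psi_sum : (\esum_(xy in offdiag A) (weight psi xy)%:E < +oo)%E)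
    (p : R -> K A -> R)
    (p_semigroup : associated_semigroup psi p) :
  countable (subgroup_gen (rational_supp p)) /\
  (forall t : R, 0 <= t -> supp (p t) `<=` rational_supp p).
Proof.
split.
  apply: countable_subgroup_gen; apply: bigcup_countable => [|q /= q0].
    exact: countableP.
  have [[pP _ _] _] := p_semigroup; apply/countable_supp/pP.
  by rewrite /= ler0q.
move=> t t0 g ptg; have t1 : t < t + 1 by rewrite ltrDl.
have [q] := rat_in_itvoo t1; rewrite in_itv /= => /andP[tq _].
exists q; first by rewrite /= -(ler0q R) (le_trans t0)// ltW.
exact: (supp_semigroup_le psi_ge0 psi_sum p_semigroup A_nonempty t0 (ltW tq)).
Qed.
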